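(* Let $n\ge 0$ be an integer, $N=2(n+1)$, and let $V_q=\mathbb{R}^N$ with coordinates $(q_1,\dots,q_N)$ and $V_a=\{(a_1,\dots,a_{N-1})\in\mathbb{R}^{N-1} : a_i>0 \text{ for all } i\}$. Define $G:V_q\to V_a$ by $$G(q_1,\dots,q_N)=\left(e^{q_1-q_2},\,e^{q_2-q_3},\dots,e^{q_{N-1}-q_N}\right).$$ On $V_q$ let $w_2$ be the constant skew-symmetric bracket determined by $$\{q_i,q_j\}_{w_2}=1\qquad\text{for all } 1\le i<j\le N,$$ and let $w_3$ be the skew-symmetric bracket determined by $$\{q_i,q_j\}_{w_3}=e^{q_{i-1}-q_i}+(1-\delta_{i+1,j})\,e^{q_i-q_{i+1}}+e^{q_{j-1}-q_j}+e^{q_j-q_{j+1}}\qquad\text{for all } 1\le i<j\le N,$$ where $\delta$ is the Kronecker delta and any exponential term involving $q_0$ or $q_{N+1}$ is omitted. Define the functions on $V_q$ $$i_0=\sum_{k=1}^{N}(-1)^{k+1}q_k=q_1-q_2+q_3-q_4+\dots+q_{N-1}-q_N,\qquad i_1=\sum_{k=1}^{N-1}e^{q_k-q_{k+1}}.$$ Then $G:(w_2,w_3,i_1,i_0)\to(v_2,v_3,I_1,I_0)$ is a symplectic bi-hamiltonian realization of the KM-system, that is: (1) $w_2$ is a symplectic Poisson bracket, its matrix $(\{q_i,q_j\}_{w_2})_{1\le i,j\le N}$ having determinant $1$, and $w_3$ is a Poisson bracket on $V_q$; (2) $G$ is a surjective submersion onto $V_a$ which is a Poisson map from $(V_q,w_2)$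 to $(V_a,v_2)$ and from $(V_q,w_3)$ to $(V_a,v_3)$, i.e. $\{f\circ G,g\circ G\}_{w_k}=\{f,g\}_{v_k}\circ G$ for all $f,g\in C^\infty(V_a)$ and $k=2,3$; (3) $i_1=I_1\circ G$ and $i_0=I_0\circ G$; (4) $w_2\,di_1=w_3\,di_0$, i.e. $\{f,i_1\}_{w_2}=\{f,i_0\}_{w_3}$ for all $f\in C^\infty(V_q)$.
   Context: The KM-system (Volterra system) on $V_a$ is $\dot a_i=a_i(a_{i+1}-a_{i-1})$, $i=1,\dots,N-1$, with $a_0=a_N=0$. The brackets $v_2,v_3$ on $V_a$ are the following known Poisson brackets of the KM-system (skew-symmetric, extended to smooth functions as biderivations). Quadratic bracket $v_2$: $\{a_i,a_{i+1}\}_{v_2}=a_ia_{i+1}$ for $1\le i\le N-2$, and $\{a_i,a_j\}_{v_2}=0$ whenever $j>i+1$. Cubic bracket $v_3$: $\{a_i,a_{i+1}\}_{v_3}=a_ia_{i+1}(a_i+a_{i+1})$ for $1\le i\le N-2$, $\{a_i,a_{i+2}\}_{v_3}=a_ia_{i+1}a_{i+2}$ for $1\le i\le N-3$, and $\{a_i,a_j\}_{v_3}=0$ whenever $j>i+2$. $L$ denotes the $N\times N$ Lax matrix of the KM-system: $L_{i,i+1}=1$ and $L_{i+1,i}=a_i$ for $1\le i\le N-1$, all other entries being $0$. The functions $I_1,I_0$ on $V_a$ are $I_1=\frac12\operatorname{tr}(L^2)$ and $I_0=\log|\det L|$. The KM-system is the Hamiltonian system $\dot a_i=\{a_i,I_1\}_{v_2}$.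 For a Poisson bracket $w$ and a function $h$, $w\,dh$ denotes the Hamiltonian vector field $f\mapsto\{f,h\}_w$. A bracket defined on coordinate functions is extended to all smooth functions by the Leibniz rule (as a bivector field). *)

(* Defs.v *)
From mathcomp Require Import all_boot all_order all_algebra.
From mathcomp Require Import all_classical all_reals all_analysis.
Set Implicit Arguments.
Unset Strict Implicit.
Unset Printing Implicit Defensive.
Import Order.TTheory GRing.Theory Num.Theory.
Import numFieldNormedType.Exports.
Local Open Scope classical_set_scope.
Local Open Scope ring_scope.

(* Coordinates of R^m are numbered from 1, and x_k = 0 when k is not in
   {1, ..., m}. *)
Definition co (R : realType) (m : nat) (x : 'rV[R]_m) (k : nat) : R :=
  if k is k'.+1 then oapp (x 0) 0 (insub k') else 0.

Definition partial (R : realType) (m : nat) (i : 'I_m) (f : 'rV[R]_m -> R) :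
  'rV[R]_m -> R := fun x => 'D_(delta_mx 0 i) f x.

(* f is C^oo on the open set U: its iterated partial derivatives of all orders
   are differentiable at every point of U. Functions on U are represented by
   total functions; only their values on U matter, since at a point of the open
   set U a derivative depends only on the restriction to U. *)
Definition smooth_on (R : realType) (m : nat) (U : set 'rV[R]_m)
    (f : 'rV[R]_m -> R) : Prop :=
  forall (s : seq 'I_m) (x : 'rV[R]_m), U x ->
    differentiable (foldr (@partial R m) f s) x.

Definition smooth (R : realType) (m : nat) (f : 'rV[R]_m -> R) : Prop :=
  smooth_on setT f.

Definition smooth_map (R : realType) (m p : nat) (F : 'rV[R]_m -> 'rV[R]_p) :
  Prop := forall j : 'I_p, smooth (fun x => F x 0 j).

Definition submersion (R : realType) (m p : nat) (F : 'rV[R]_m -> 'rV[R]_p) :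
  Prop :=
  smooth_map F /\ forall x : 'rV[R]_m, range ('d F x : _ -> 'rV[R]_p) = setT.

Definition bracket (R : realType) (m : nat) : Type :=
  ('rV[R]_m -> R) -> ('rV[R]_m -> R) -> 'rV[R]_m -> R.

Record poisson_bracket (R : realType) (m : nat) (br : bracket R m) : Prop := {
  poisson_smooth : forall f g, smooth f -> smooth g -> smooth (br f g);
  poisson_skew : forall f g, smooth f -> smooth g ->
    forall x, br f g x = - br g f x;
  poisson_linear : forall (c : R) f g h, smooth f -> smooth g -> smooth h ->
    forall x, br (fun y => c * f y + g y) h x = c * br f h x + br g h x;
  poisson_leibniz : forall f g h, smooth f -> smooth g -> smooth h ->
    forall x, br (fun y => f y * g y) h x = f x * br g h x + br f h x * g x;
  poisson_jacobi : forall f g h, smooth f -> smooth g -> smooth h ->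
    forall x, br f (br g h) x + br g (br h f) x + br h (br f g) x = 0
}.

Definition bracket_mx (R : realType) (m : nat) (br : bracket R m)
    (x : 'rV[R]_m) : 'M[R]_m :=
  \matrix_(i, j) br (fun y => y 0 i) (fun y => y 0 j) x.

Definition symplectic_bracket (R : realType) (m : nat) (br : bracket R m) :
  Prop :=
  poisson_bracket br /\ forall x : 'rV[R]_m, bracket_mx br x \in unitmx.

(* F : R^m -> V, with V open in R^p, is a Poisson map. *)
Definition poisson_map (R : realType) (m p : nat) (br : bracket R m)
    (V : set 'rV[R]_p) (br' : bracket R p) (F : 'rV[R]_m -> 'rV[R]_p) : Prop :=
  forall f g : 'rV[R]_p -> R, smooth_on V f -> smooth_on V g ->
    forall x : 'rV[R]_m, br (f \o F) (g \o F) x = br' f g (F x).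

(* The skew-symmetric biderivation with {x_i, x_j} = t i j for
   1 <= i < j <= m; an ordinal i stands for the index i.+1. *)
Definition skew_ext (R : realType) (m : nat)
    (t : nat -> nat -> 'rV[R]_m -> R) (i j : 'I_m) (x : 'rV[R]_m) : R :=
  if (i < j)%N then t i.+1 j.+1 x
  else if (j < i)%N then - t j.+1 i.+1 x
  else 0.

Definition bivector_bracket (R : realType) (m : nat)
    (t : nat -> nat -> 'rV[R]_m -> R) : bracket R m :=
  fun f g x => \sum_(i < m) \sum_(j < m)
    skew_ext t i j x * partial i f x * partial j g x.

Definition Va (R : realType) (N : nat) : set 'rV[R]_N.-1 :=
  [set a | forall i, 0 < a 0 i].

Definition v2 (R : realType) (N : nat) : bracket R N.-1 :=
  bivector_bracket (fun i j a =>
    if j == i.+1 then co a i * co a i.+1 else 0).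

Definition v3 (R : realType) (N : nat) : bracket R N.-1 :=
  bivector_bracket (fun i j a =>
    if j == i.+1 then co a i * co a i.+1 * (co a i + co a i.+1)
    else if j == i.+2 then co a i * co a i.+1 * co a i.+2
    else 0).

Definition lax (R : realType) (N : nat) (a : 'rV[R]_N.-1) : 'M[R]_N :=
  \matrix_(i, j) if j == i.+1 :> nat then 1
                 else if i == j.+1 :> nat then co a j.+1
                 else 0.

Definition I1 (R : realType) (N : nat) (a : 'rV[R]_N.-1) : R :=
  2^-1 * \tr (lax a ^+ 2).

Definition I0 (R : realType) (N : nat) (a : 'rV[R]_N.-1) : R :=
  ln `|\det (lax a)|.

Definition G (R : realType) (N : nat) (q : 'rV[R]_N) : 'rV[R]_N.-1 :=
  \row_k expR (co q k.+1 - co q k.+2).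

(* exp(q_k - q_(k+1)), omitted (that is, 0) if it involves q_0 or q_(N+1). *)
Definition expq (R : realType) (N : nat) (q : 'rV[R]_N) (k : nat) : R :=
  if (0 < k < N)%N then expR (co q k - co q k.+1) else 0.

Definition w2 (R : realType) (N : nat) : bracket R N :=
  bivector_bracket (fun i j q => 1).

Definition w3 (R : realType) (N : nat) : bracket R N :=
  bivector_bracket (fun i j q =>
    expq q i.-1 + (1 - (i.+1 == j)%:R) * expq q i + expq q j.-1 + expq q j).

Definition i0 (R : realType) (N : nat) (q : 'rV[R]_N) : R :=
  \sum_(1 <= k < N.+1) (-1) ^+ k.+1 * co q k.

Definition i1 (R : realType) (N : nat) (q : 'rV[R]_N) : R :=
  \sum_(1 <= k < N) expR (co q k - co q k.+1).

(* Main.v *)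
Require Import Defs.
From mathcomp Require Import all_boot all_order all_algebra.
From mathcomp Require Import all_classical all_reals all_analysis.
From mathcomp Require Import ring zify.
Import Order.TTheory GRing.Theory Num.Theory.
Import numFieldNormedType.Exports.
Local Open Scope classical_set_scope.
Local Open Scope ring_scope.

(* With a_k = exp(q_k - q_(k+1)) and a_0 = a_N = 0, every bracket in sight is
   governed by the derivation rule {q_i, a_k} = a_k (b_(i,k) - b_(i,k+1)), where
   b_(i,j) = {q_i, q_j}. The coefficients of w2 and w3 being constants or sums of
   the a_k, the Poisson property of G and the Jacobi identity of w3 become
   identities between sequences, checked by comparing the indices. The Jacobi
   identity for arbitrary functions follows from the one for coordinates by the
   symmetry of second derivatives. The congruence by the basis
   (q_1 - q_2, ..., q_(N-1) - q_N, q_N) makes the matrix of w2 tridiagonal with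
   zero diagonal, like the Lax matrix; such a determinant of even size is a
   product of 2 x 2 blocks. Finally w2 di_1 = w3 di_0 telescopes over the pairs
   q_(2k+1) - q_(2k+2) of i_0. *)

(** * Brackets of sequences *)

Ltac decide_ifs :=
  repeat match goal with
  | |- context [if ?c then _ else _] =>
      first [have -> : c = true by lia | have -> : c = false by lia]
  | |- context [nat_of_bool ?c] =>
      first [have -> : c = true by lia | have -> : c = false by lia]
  end.

Section CubicJacobi.
Context {R : comNzRingType}.

(** Indices are arbitrary naturals rather than ordinals, so that a neighbour such as [m.+1] never
    leaves the domain. *)
Definition skewn (t : nat -> nat -> R) (i j : nat) : R :=
  if (i < j)%N then t i j else if (j < i)%N then - t j i else 0.

Lemma skewnC t i j : skewn t i j = - skewn t j i.
Proof. by rewrite /skewn; case: ltngtP; rewrite ?opprK ?oppr0. Qed.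

(** Linear in [a]: evaluated at the sequence of derivatives of the a_m, it yields the derivative of
    {q_i, q_j}. *)
Definition w3_coef (a : nat -> R) (i j : nat) : R :=
  a i.-1 + (1 - (i.+1 == j)%:R) * a i + a j.-1 + a j.

(* {q_i, a_m} when {q_i, q_j} = w3_coef a i j for i < j *)
Definition coord_exp_bracket (a : nat -> R) (i m : nat) : R :=
  a m * (skewn (w3_coef a) i m - skewn (w3_coef a) i m.+1).

(** The terms are {q_i, {q_j, q_k}} and its rotations. The shape of the coefficients depends only on
    whether each of the gaps j - i and k - j is 1, 2 or larger, which leaves nine polynomial
    identities. *)
Lemma skewn_w3_coef_jacobi_lt (a : nat -> R) i j k :
  (0 < i)%N -> (i < j)%N -> (j < k)%N ->
  skewn (w3_coef (coord_exp_bracket a i)) j k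
    + skewn (w3_coef (coord_exp_bracket a j)) k i
    + skewn (w3_coef (coord_exp_bracket a k)) i j = 0.
Proof.
case: i => // i _ ij jk.
have [d dE] : exists d, j = (i.+2 + d)%N by exists (j - i.+2)%N; lia.
have [e eE] : exists e, k = (j.+1 + e)%N by exists (k - j.+1)%N; lia.
subst k; subst j => {ij jk}.
case: d => [|[|d]]; case: e => [|[|e]];
  rewrite /skewn /w3_coef /coord_exp_bracket /skewn /w3_coef;
  rewrite ?addn0 ?addn1 ?addn2 ?addSn ?addnS /=;
  decide_ifs; rewrite ?addn0 ?addn1 ?addSn /=; ring.
Qed.

(** The cyclic sum is invariant under rotation, changes sign under a transposition and vanishes on a
    repeated index, so increasing indices suffice. *)
Lemma skewn_w3_coef_jacobi (a : nat -> R) i j k :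
  (0 < i)%N -> (0 < j)%N -> (0 < k)%N ->
  skewn (w3_coef (coord_exp_bracket a i)) j k
    + skewn (w3_coef (coord_exp_bracket a j)) k i
    + skewn (w3_coef (coord_exp_bracket a k)) i j = 0.
Proof.
pose J i j k := skewn (w3_coef (coord_exp_bracket a i)) j k
    + skewn (w3_coef (coord_exp_bracket a j)) k i
    + skewn (w3_coef (coord_exp_bracket a k)) i j.
have Jrot x y z : J x y z = J y z x by rewrite /J; ring.
have JN x y z : J x y z = - J y x z.
  rewrite /J (skewnC _ y z) (skewnC _ z x) (skewnC _ x y); ring.
have J2 x y : J x x y = 0.
  by rewrite /J (skewnC _ x y) [skewn _ x x]/skewn ltnn addNr addr0.
have Jlt x y z : (0 < x)%N -> (x < y)%N -> (y < z)%N -> J x y z = 0.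
  exact: skewn_w3_coef_jacobi_lt.
move=> i0 j0 k0; rewrite -/(J i j k).
case: (ltngtP i j) => [ij|ji|->]; last exact: J2.
- case: (ltngtP j k) => [jk|kj|->]; [exact: Jlt| |by rewrite Jrot J2].
  case: (ltngtP i k) => [ik|ki|->]; [|by rewrite -Jrot Jlt|by rewrite -Jrot J2].
  by rewrite JN Jrot Jlt// oppr0.
- case: (ltngtP j k) => [jk|kj|->]; [|by rewrite JN -Jrot Jlt// oppr0|by rewrite Jrot J2].
  case: (ltngtP i k) => [ik|ki|->]; [|by rewrite Jrot Jlt|by rewrite -Jrot J2].
  by rewrite JN Jlt// oppr0.
Qed.

End CubicJacobi.

(** * Determinant and trace of tridiagonal matrices with zero diagonal *)

Section Tridiagonal.
Context {R : comNzRingType}.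
Implicit Types (u l : nat -> R) (N : nat).

Lemma sum_ord_eq N k (F : nat -> R) :
  \sum_(i < N) (i == k :> nat)%:R * F i = (k < N)%N%:R * F k.
Proof.
case: ltnP => kN; last first.
  rewrite mul0r big1// => i _.
  by rewrite (ltn_eqF (leq_trans (ltn_ord i) kN)) mul0r.
rewrite (bigD1 (Ordinal kN))//= eqxx big1 ?addr0// => i ik.
by rewrite (_ : (_ == _) = false) ?mul0r//; apply/negbTE.
Qed.

(** The entries come from sequences, so that deleting the first two rows and columns just shifts [u]
    and [l] by two. *)
Definition tridiag u l N : 'M[R]_N :=
  \matrix_(i, j) if j == i.+1 :> nat then u i
                 else if i == j.+1 :> nat then l j else 0.

(** The only nonzero entry of the first row is [u 0] in the second column; in its minor, the only
    nonzero entry of the first column is [l 0]. *)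
Lemma det_tridiagSS u l N : \det (tridiag u l N.+2) =
  - (u 0%N * l 0%N) * \det (tridiag (fun k => u k.+2) (fun k => l k.+2) N).
Proof.
rewrite (expand_det_row _ ord0) (bigD1 (lift ord0 ord0))//= big1 => [|j j1].
  rewrite addr0 mxE/= /cofactor (expand_det_col _ ord0) (bigD1 ord0)//= big1 => [|i i0].
    rewrite addr0 !mxE/= /cofactor/= addn0 expr0 mul1r expr1.
    rewrite [\det _](_ : _ = \det (tridiag (fun k => u k.+2) (fun k => l k.+2) N)).
      by ring.
    by congr (\det _); apply/matrixP => i j; rewrite !mxE.
  by rewrite !mxE/=; case: i i0 => -[|i]//= ? _; rewrite mul0r.
by rewrite mxE/=; case: j j1 => -[|[|j]]//= ? _; rewrite mul0r.
Qed.

Lemma det_tridiag u l n :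
  \det (tridiag u l (2 * n)) = \prod_(k < n) - (u (2 * k)%N * l (2 * k)%N).
Proof.
elim: n u l => [|n IH] u l; first by rewrite muln0 big_ord0 det_mx00.
rewrite mulnS det_tridiagSS IH big_ord_recl; congr (_ * _).
by apply: eq_bigr => k _; rewrite /bump/= mulnDr.
Qed.

(** A closed walk of length two crosses some edge {k, k+1} forth and back; it can start at either
    end, whence the factor 2. *)
Lemma mxtrace_sqr_tridiag u l N :
  \tr (tridiag u l N ^+ 2) = 2 * \sum_(k < N.-1) u k * l k.
Proof.
transitivity (\sum_(i < N) \sum_(j < N)
    ((j == i.+1 :> nat)%:R * (u i * l i) + (i == j.+1 :> nat)%:R * (u j * l j))).
  apply: eq_bigr => i _; rewrite mxE; apply: eq_bigr => j _; rewrite !mxE.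
  case: (j =P i.+1 :> nat) => ji; case: (i =P j.+1 :> nat) => ij;
    [by exfalso; lia|rewrite /=; ring..].
rewrite (eq_bigr (fun i : 'I_N => (i.+1 < N)%N%:R * (u i * l i) +
  \sum_(j < N) (i == j.+1 :> nat)%:R * (u j * l j))) => [|i _]; last first.
  by rewrite big_split/= (sum_ord_eq _ _ (fun=> _)).
rewrite big_split/= exchange_big/=.
rewrite [X in _ + X](eq_bigr (fun i : 'I_N => (i.+1 < N)%N%:R * (u i * l i))); last first.
  by move=> i _; rewrite (sum_ord_eq _ _ (fun=> _)).
set S := \sum_(i < N) _; suff -> : S = \sum_(k < N.-1) u k * l k by ring.
rewrite /S; case: N {S} => [|N]; first by rewrite !big_ord0.
rewrite big_ord_recr/= ltnn mul0r addr0; apply: eq_bigr => k _.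
by rewrite ltnS ltn_ord mul1r.
Qed.

Lemma det_skew_ones n : \det (\matrix_(i < 2 * n, j < 2 * n)
   ((i < j)%N%:R - (j < i)%N%:R : R)) = 1.
Proof.
set N := (2 * n)%N; set S := \matrix_(i, j) _.
(* The rows of [P] are the coordinates of q_i - q_(i+1) and, for the last one, of q_N; [P] is
   unitriangular. *)
pose P : 'M[R]_N := \matrix_(i, j) ((j == i :> nat)%:R - (j == i.+1 :> nat)%:R).
have detP : \det P = 1.
  rewrite -det_tr det_trig.
    rewrite big1// => i _; rewrite !mxE eqxx.
    by rewrite (_ : (_ == _) = false) ?subr0//; lia.
  apply/is_trig_mxP => i j ij; rewrite !mxE.
  have -> : (i == j :> nat) = false by lia.
  by have -> : (i == j.+1 :> nat) = false; [lia|rewrite subrr].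
have PSP : P *m S *m P^T = tridiag (fun=> 1) (fun=> -1) N.
  pose s i j : R := (i < j)%N%:R - (j < i)%N%:R.
  (* Left multiplication by [P] subtracts from each row the next one; the factor [(i.+1 < N)%N%:R]
     is there for the last row, which has no successor. *)
  have PS i (j : 'I_N) : (P *m S) i j = s i j - (i.+1 < N)%N%:R * s i.+1 j.
    rewrite mxE.
    under eq_bigr do rewrite !mxE mulrBl.
    rewrite big_split sumrN/= (sum_ord_eq _ _ (fun k => s k j)).
    by rewrite (sum_ord_eq _ _ (fun k => s k j)) ltn_ord mul1r.
  apply/matrixP => i j; rewrite mxE.
  pose s' k := s i k - (i.+1 < N)%N%:R * s i.+1 k.
  rewrite (eq_bigr (fun k : 'I_N => (k == j :> nat)%:R * s' k - (k == j.+1 :> nat)%:R * s' k)).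
    rewrite big_split sumrN/= !sum_ord_eq !mxE ltn_ord mul1r /s' /s.
    have iN := ltn_ord i; have jN := ltn_ord j.
    move: (nat_of_ord i) (nat_of_ord j) iN jN => a b aN bN.
    have [ab|ab|ab] := ltngtP a b;
      have [b1|b1] := eqVneq b a.+1; have [a1|a1] := eqVneq a b.+1;
      have [aN1|aN1] := ltnP a.+1 N; have [bN1|bN1] := ltnP b.+1 N;
      try (by exfalso; lia);
    decide_ifs;
    rewrite /=; ring.
  by move=> k _; rewrite PS !mxE /s'; ring.
have : \det (P *m S *m P^T) = \det S by rewrite !det_mulmx det_tr detP mul1r mulr1.
rewrite PSP det_tridiag => <-.
by rewrite big1// => k _; rewrite mul1r opprK.
Qed.

End Tridiagonal.

(** * Brackets of the exponentials and of the Hamiltonians *)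

Section ExpBracket.
Context {R : comNzRingType}.
Implicit Types (a c : nat -> R) (b : nat -> nat -> R).

(* {a_i, a_j} when {q_i, q_j} = b i j *)
Definition exp_bracket a b i j : R :=
  a i * a j * (b i j - b i.+1 j - b i j.+1 + b i.+1 j.+1).

(** Both sides are skew-symmetric, so the pairs i < j suffice. *)
Let exp_bracket_skew a t t' : (forall i j, (0 < i)%N -> (i < j)%N -> exp_bracket a (skewn t) i j = t' i j) ->
  forall i j, (0 < i)%N -> (0 < j)%N -> exp_bracket a (skewn t) i j = skewn t' i j.
Proof.
move=> E i j i0 j0; rewrite {2}/skewn; case: ltngtP => [ij|ji|<-].
- exact: E.
- rewrite -E// /exp_bracket (skewnC _ i j) (skewnC _ i.+1 j) (skewnC _ i j.+1).
  rewrite (skewnC _ i.+1 j.+1); ring.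
- by rewrite /exp_bracket (skewnC _ i.+1 i) /skewn !ltnn; ring.
Qed.

(** The mixed second difference of a constant is 0; for i < j the four index pairs stay above the
    diagonal unless j = i + 1, where (i+1, j) lies on it. *)
Lemma exp_bracket_quadratic a i j : (0 < i)%N -> (0 < j)%N ->
  exp_bracket a (skewn (fun _ _ => 1)) i j =
  skewn (fun i j => if j == i.+1 then a i * a i.+1 else 0) i j.
Proof.
apply: exp_bracket_skew => {}i {}j i0 ij.
have [d ->] : exists d, j = (i.+1 + d)%N by exists (j - i.+1)%N; lia.
case: d => [|d]; rewrite /exp_bracket /skewn ?addn0 ?addSn ?addnS /=; decide_ifs; ring.
Qed.

(** Off the Kronecker term, [w3_coef a i j] is a function of i plus a function of j, which the mixed
    second difference kills. Only j = i + 1 and j = i + 2 meet the diagonal or the Kronecker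
    term. *)
Lemma exp_bracket_cubic a i j : (0 < i)%N -> (0 < j)%N ->
  exp_bracket a (skewn (w3_coef a)) i j =
  skewn (fun i j => if j == i.+1 then a i * a i.+1 * (a i + a i.+1)
                   else if j == i.+2 then a i * a i.+1 * a i.+2 else 0) i j.
Proof.
apply: exp_bracket_skew => {}i {}j; case: i => // i _ ij.
have [d ->] : exists d, j = (i.+2 + d)%N by exists (j - i.+2)%N; lia.
case: d => [|[|d]]; rewrite /exp_bracket /w3_coef /skewn ?addn0 ?addn1 ?addSn ?addnS /=;
  decide_ifs; rewrite ?addn1 ?addn0 /=; ring.
Qed.

Lemma sum_alternating c M :
  \sum_(1 <= k < (2 * M).+1) (-1) ^+ k.+1 * c k =
  \sum_(k < M) (c (2 * k).+1 - c (2 * k).+2).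
Proof.
elim: M => [|M IH]; first by rewrite muln0 big_geq// big_ord0.
rewrite mulnS !addSn add0n 2?big_nat_recr//= IH big_ord_recr/= -addrA; congr (_ + _).
by rewrite !exprS exprM sqrrN expr1n expr1n; ring.
Qed.

(** For the induction on M, the partial sums are needed also when i lies beyond 2M. The boundary
    terms are multiples of a_(2M), which vanishes in the application, where 2M = N. *)
Lemma alternating_sum_w3_coef a M i : a 0%N = 0 -> (0 < i)%N ->
  \sum_(k < M) (skewn (w3_coef a) i (2 * k).+1 - skewn (w3_coef a) i (2 * k).+2) =
  if (i <= 2 * M)%N then - (a i.-1 + a i) - (1 - (i == 2 * M)%N%:R) * a (2 * M)%N
  else (1 - ((2 * M).+1 == i)%:R) * a (2 * M)%N.
Proof.
move=> a0; case: i => // i _; elim: M => [|M IH].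
  by rewrite big_ord0 muln0 a0 /= !mulr0.
rewrite big_ord_recr/= IH mulnS add2n; move: (2 * M)%N => k {IH}.
(* The index, now [i.+1], is compared with the new pair [k.+1], [k.+2]: it is beyond [k.+1], equal
   to it, or at most [k]. *)
have [ki|] := ltnP k i.
  have [d ->] : exists d, i = (k.+1 + d)%N by exists (i - k.+1)%N; lia.
  case: d => [|[|d]]; rewrite /skewn /w3_coef ?addn0 ?addn1 ?addSn ?addnS /=;
    decide_ifs; rewrite ?addn1 ?addn0 /=; ring.
rewrite leq_eqVlt => /predU1P[->|ik].
  rewrite /skewn /w3_coef /=; decide_ifs; rewrite /=; ring.
have [d ->] : exists d, k = (i.+1 + d)%N by exists (k - i.+1)%N; lia.
case: d => [|d]; rewrite /skewn /w3_coef ?addn0 ?addn1 ?addSn ?addnS /=;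
    decide_ifs; rewrite ?addn1 ?addn0 /=; ring.
Qed.

(** As a function of k, {q_i, q_k} is the sign of k - i, which jumps by 1 only from i - 1 to i and
    from i to i + 1. *)
Lemma sum_exp_bracket_ones a N i : a 0%N = 0 -> a N = 0 -> (0 < i <= N)%N ->
  \sum_(1 <= k < N) a k * (skewn (fun _ _ => 1) i k - skewn (fun _ _ => 1) i k.+1) =
  - (a i.-1 + a i).
Proof.
move=> a0 aN; case: i => // i /= iN.
transitivity (\sum_(k < N) ((k == i :> nat)%:R * - a k + (k == i.+1 :> nat)%:R * - a k)).
  rewrite -(big_mkord xpredT (fun k => (k == i)%:R * - a k + (k == i.+1)%:R * - a k)).
  (* The sum over ordinals also contains k = 0, which contributes nothing since a_0 = 0. *)
  rewrite [RHS]big_ltn ?(leq_ltn_trans _ iN)// a0 oppr0 !mulr0 !add0r.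
  apply: eq_bigr => k _; rewrite /skewn.
  have [->|ki] := eqVneq k i; first by decide_ifs; rewrite /=; ring.
  have [->|ki'] := eqVneq k i.+1; first by decide_ifs; rewrite /=; ring.
  have [?|?] : (k < i)%N \/ (i.+1 < k)%N by lia.
    by decide_ifs; rewrite /=; ring.
  by decide_ifs; rewrite /=; ring.
rewrite big_split /= (sum_ord_eq _ _ (fun k => - a k)) iN mul1r.
rewrite (sum_ord_eq _ _ (fun k => - a k)).
move: iN; rewrite leq_eqVlt => /predU1P[->|->]; last by rewrite /=; ring.
by rewrite aN ltnn /=; ring.
Qed.
End ExpBracket.

(** * Symmetry of second derivatives *)

Section Schwarz.
Context {R : realType} {V : normedModType R}.
Implicit Types (f : V -> R) (u v x y : V).

Lemma is_derive_line f y u s : derivable f (y + s *: u) u ->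
  is_derive s 1 (fun r : R => f (y + r *: u)) ('D_u f (y + s *: u)).
Proof.
have E : (fun h : R => h^-1 *: (f (h *: u + (y + s *: u)) - f (y + s *: u))) =
   (fun h : R => h^-1 *: (f (y + (h *: 1 + s) *: u) - f (y + s *: u))).
  apply/funext => h; congr (_ *: (f _ - _)).
  by rewrite scalerDl [h *: 1]mulr1 addrCA.
move=> df; split.
  by rewrite /derivable/= -E.
by rewrite /derive /= -E.
Qed.

Lemma MVT_line f y u h : (forall z, derivable f z u) -> 0 < h ->
  exists2 c, 0 < c < h & f (y + h *: u) - f y = 'D_u f (y + c *: u) * h.
Proof.
move=> df h0.
have fd (s : R) : is_derive s 1 (fun r : R => f (y + r *: u)) ('D_u f (y + s *: u)).
  exact: is_derive_line.
have [|c ch] := @MVT R _ _ 0 h h0 (fun s _ => fd s).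
  apply: derivable_within_continuous => s _.
  by have [] := fd s.
by rewrite scale0r addr0 subr0; exists c.
Qed.

(** Mean value theorem twice: along u for z -> f (z + h v) - f z, then along v for ['D_u f]. *)
Lemma second_difference f x u v h :
  (forall z, derivable f z u) -> (forall z, derivable ('D_u f) z v) -> 0 < h ->
  exists c d, [/\ 0 < c < h, 0 < d < h &
    f (x + h *: v + h *: u) - f (x + h *: u) - (f (x + h *: v) - f x) =
    'D_v ('D_u f) (x + c *: u + d *: v) * h * h].
Proof.
move=> fu fuv h0.
pose g z := f (z + h *: v) - f z.
have gd z : is_derive z u g ('D_u f (z + h *: v) - 'D_u f z).
  apply: is_deriveB; last exact: DeriveDef.
  have E : (fun r : R => r^-1 *: (f (r *: u + (z + h *: v)) - f (z + h *: v))) =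
    (fun r : R => r^-1 *: (f (r *: u + z + h *: v) - f (z + h *: v))).
    by apply/funext => r; rewrite addrA.
  split; first by rewrite /derivable /= -E; exact: fu.
  by rewrite /derive /= -E.
have gu z : derivable g z u by have [] := gd z.
have gE z : 'D_u g z = 'D_u f (z + h *: v) - 'D_u f z by have [] := gd z.
have [c ch gc] := MVT_line g x u h gu h0.
have [d dh dc] := MVT_line _ (x + c *: u) v h fuv h0.
exists c, d; split => //.
rewrite -dc.
rewrite gE in gc.
rewrite -gc /g (addrAC x).
ring.
Qed.

(** The second difference is symmetric in u and v, so the two mixed derivatives agree at a pair of
    points arbitrarily close to x; continuity at x concludes. *)
Lemma schwarz f x u v :
  (forall z, derivable f z u) -> (forall z, derivable f z v) ->
  (forall z, derivable ('D_u f) z v) -> (forall z, derivable ('D_v f) z u) ->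
  {for x, continuous ('D_v ('D_u f))} -> {for x, continuous ('D_u ('D_v f))} ->
  'D_v ('D_u f) x = 'D_u ('D_v f) x.
Proof.
move=> fu fv fuv fvu cuv cvu.
apply/eqP; rewrite -subr_eq0 -normr_le0; apply/ler_addgt0Pr => e e0.
have e20 : 0 < e / 2 by rewrite divr_gt0.
have /cvgrPdist_lt/(_ _ e20)/nbhs_ballP[r1 /= r10 H1] := cuv.
have /cvgrPdist_lt/(_ _ e20)/nbhs_ballP[r2 /= r20 H2] := cvu.
have [r [r0 rr1 rr2]] : exists r, [/\ 0 < r, r <= r1 & r <= r2].
  by exists (Num.min r1 r2); rewrite lt_min r10 r20 !ge_min !lexx orbT.
have K0 : 0 < `|u| + `|v| + 1 by rewrite ltr_wpDl// addr_ge0.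
(* This h keeps both intermediate points within r of x; the [+ 1] in the witness keeps its
   denominator positive when u = v = 0. *)
have [h h0 hE] : exists2 h, 0 < h & h * (`|u| + `|v|) < r.
  exists (r / (`|u| + `|v| + 1)); first by rewrite divr_gt0.
  by rewrite mulrAC ltr_pdivrMr// ltr_pM2l// ltrDl.
have small c d : 0 < c < h -> 0 < d < h -> `|x - (x + c *: u + d *: v)| < r.
  move=> /andP[c0 ch] /andP[d0 dh].
  rewrite -addrA opprD addrA subrr sub0r normrN.
  apply: le_lt_trans hE.
  rewrite mulrDr; apply: (le_trans (ler_normD _ _)).
  by rewrite !normrZ !gtr0_norm// lerD// ler_wpM2r// ltW.
have [c [d [ch dh E1]]] := second_difference f x u v h fu fuv h0.
have [d' [c' [dh' ch' E2]]] := second_difference f x v u h fv fvu h0.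
have E : 'D_v ('D_u f) (x + c *: u + d *: v) =
         'D_u ('D_v f) (x + d' *: v + c' *: u).
  move: E1 E2; rewrite (addrAC x (h *: v)).
  move: ('D_v _ _) ('D_u ('D_v _) _) => A B E1 E2.
  apply: (mulIf (lt0r_neq0 h0)); apply: (mulIf (lt0r_neq0 h0)).
  apply: etrans (esym E1) (etrans _ E2).
  move: (f _) (f _) (f _) (f _) => a1 a2 a3 a4; ring.
have B1 := H1 (x + c *: u + d *: v).
have B2 := H2 (x + d' *: v + c' *: u).
rewrite /= -!ball_normE /= in B1 B2.
have {}B1 : `|'D_v ('D_u f) x - 'D_v ('D_u f) (x + c *: u + d *: v)| < e / 2.
  exact/B1/(lt_le_trans (small c d ch dh)).
have {}B2 : `|'D_u ('D_v f) x - 'D_u ('D_v f) (x + d' *: v + c' *: u)| < e / 2.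
  by apply: B2; rewrite (addrAC x) (lt_le_trans (small c' d' ch' dh')).
rewrite E in B1.
rewrite distrC in B2.
by rewrite add0r (splitr e) (le_trans (ler_distD _ _ _) (lerD (ltW B1) (ltW B2))).
Qed.

End Schwarz.

(** * Smooth functions *)

Section Smooth.
Context {R : realType} {m : nat}.
Implicit Types (f g : 'rV[R]_m -> R) (x : 'rV[R]_m) (i j : 'I_m).

Lemma smooth_differentiable f x : smooth f -> differentiable f x.
Proof. by move=> sf; exact: (sf [::]). Qed.

Lemma smooth_derivable f x v : smooth f -> derivable f x v.
Proof. by move=> sf; apply/diff_derivable/smooth_differentiable. Qed.

Lemma smooth_partial i f : smooth f -> smooth (partial i f).
Proof. by move=> sf s x _; rewrite -foldr_rcons; exact: sf. Qed.

(** Coinduction: the smooth functions form the largest set of everywhere differentiable functions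
    stable under partial derivatives. No formula for higher derivatives has to be written. *)
Lemma smooth_coind (P : set ('rV[R]_m -> R)) :
  (forall f, P f -> (forall x, differentiable f x) /\
                    forall i, P (partial i f)) ->
  P `<=` @smooth R m.
Proof.
move=> stepP f Pf s x _.
suff Ps : P (foldr (@partial R m) f s) by case: (stepP _ Ps).
by elim: s => //= i s Ps; exact: (stepP _ Ps).2.
Qed.

Lemma partialD i f g x : differentiable f x -> differentiable g x ->
  partial i (fun y => f y + g y) x = partial i f x + partial i g x.
Proof. by move=> df dg; apply: deriveD; exact: diff_derivable. Qed.

Lemma partialM i f g x : differentiable f x -> differentiable g x ->
  partial i (fun y => f y * g y) x = f x * partial i g x + g x * partial i f x.
Proof. by move=> df dg; apply: deriveM; exact: diff_derivable. Qed.

Lemma partial_cst i (c : R) : partial i (fun=> c) = fun=> 0.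
Proof. by apply/funext => x; exact: derive_cst. Qed.

Lemma is_diff_expR_comp f x : differentiable f x ->
  is_diff x (fun y => expR (f y)) (fun v => 'd f x v * expR (f x)).
Proof.
move=> df.
have de : differentiable expR (f x) by exact/derivable1_diffP/derivable_expR.
apply: DiffDef; first exact: differentiable_comp.
have -> : 'd (fun y => expR (f y)) x = 'd expR (f x) \o 'd f x :> (_ -> _).
  exact: diff_comp.
apply/funext => v /=; by rewrite diff1E// derive1E derive_val.
Qed.

Lemma partial_expR i f x : differentiable f x ->
  partial i (fun y => expR (f y)) x = partial i f x * expR (f x).
Proof.
move=> df; have [de E] := is_diff_expR_comp f x df.
by rewrite /partial !deriveE// E.
Qed.

Lemma smooth_cst (c : R) : smooth (fun _ : 'rV[R]_m => c).
Proof.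
apply: (smooth_coind [set f | exists a, f = fun=> a]); last by exists c.
move=> _ [a ->]; split=> [x|i]; first exact: differentiable_cst.
by exists 0; rewrite partial_cst.
Qed.

(* The algebra generated by smooth functions and their exponentials is stable
   under partial derivatives. *)
Inductive smooth_closure : ('rV[R]_m -> R) -> Prop :=
| closure_smooth f of smooth f : smooth_closure f
| closure_expR f of smooth f : smooth_closure (fun x => expR (f x))
| closureD f g of smooth_closure f & smooth_closure g :
    smooth_closure (fun x => f x + g x)
| closureM f g of smooth_closure f & smooth_closure g :
    smooth_closure (fun x => f x * g x).

Lemma smooth_closureP : smooth_closure `<=` @smooth R m.
Proof.
apply: smooth_coind => f; elim=> {}f => [sf|sf|g _ [df pf] _ [dg pg]|g cf [df pf] cg [dg pg]].
- split=> [x|i]; first exact: smooth_differentiable.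
  exact/closure_smooth/smooth_partial.
- have df x := smooth_differentiable f x sf.
  split=> [x|i]; first by have [] := is_diff_expR_comp f x (df x).
  rewrite (_ : partial _ _ = fun x => partial i f x * expR (f x)); last first.
    by apply/funext => x; exact: partial_expR.
  by apply: closureM; [exact/closure_smooth/smooth_partial|exact: closure_expR].
- split=> [x|i]; first exact: differentiableD.
  rewrite (_ : partial _ _ = fun x => partial i f x + partial i g x).
    exact: closureD.
  by apply/funext => x; exact: partialD.
- split=> [x|i]; first exact: differentiableM.
  rewrite (_ : partial _ _ = fun x => f x * partial i g x + g x * partial i f x).
    by apply: closureD; exact: closureM.
  by apply/funext => x; exact: partialM.
Qed.

Lemma smoothD f g : smooth f -> smooth g -> smooth (fun x => f x + g x).
Proof. by move=> sf sg; apply/smooth_closureP/closureD; exact: closure_smooth. Qed.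

Lemma smoothM f g : smooth f -> smooth g -> smooth (fun x => f x * g x).
Proof. by move=> sf sg; apply/smooth_closureP/closureM; exact: closure_smooth. Qed.

Lemma smooth_expR f : smooth f -> smooth (fun x => expR (f x)).
Proof. by move=> sf; exact/smooth_closureP/closure_expR. Qed.

Lemma smoothN f : smooth f -> smooth (fun x => - f x).
Proof.
move=> sf; rewrite (_ : (fun _ => _) = fun x => -1 * f x).
  by apply: smoothM => //; exact: smooth_cst.
by apply/funext => x; rewrite mulN1r.
Qed.

Lemma smoothB f g : smooth f -> smooth g -> smooth (fun x => f x - g x).
Proof. by move=> sf sg; apply: smoothD => //; exact: smoothN. Qed.

Lemma smooth_sum (I : Type) (r : seq I) (P : pred I) (F : I -> 'rV[R]_m -> R) :
  (forall k, P k -> smooth (F k)) -> smooth (fun x => \sum_(k <- r | P k) F k x).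
Proof.
move=> sF; elim: r => [|k r IH].
  rewrite (_ : (fun _ => _) = fun=> 0); first exact: smooth_cst.
  by apply/funext => x; rewrite big_nil.
case: (boolP (P k)) => Pk.
  rewrite (_ : (fun _ => _) = fun x => F k x + \sum_(k <- r | P k) F k x).
    by apply: smoothD => //; exact: sF.
  by apply/funext => x; rewrite big_cons Pk.
rewrite (_ : (fun _ => _) = fun x => \sum_(k <- r | P k) F k x)//.
by apply/funext => x; rewrite big_cons (negPf Pk).
Qed.

Lemma partialC i j f x : smooth f ->
  partial i (partial j f) x = partial j (partial i f) x.
Proof.
move=> sf; apply: schwarz => [z|z|z|z||].
1-4: by apply: smooth_derivable; do ?exact: smooth_partial.
all: by apply/differentiable_continuous/smooth_differentiable; do 2!apply: smooth_partial.
Qed.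

(** Differentiability is proved along with the formula because the induction step applies [partialD]
    to the remaining sum. *)
Lemma partial_sum (I : Type) (r : seq I) (P : pred I) (F : I -> 'rV[R]_m -> R) i x :
  (forall k, P k -> differentiable (F k) x) ->
  differentiable (fun y => \sum_(k <- r | P k) F k y) x /\
  partial i (fun y => \sum_(k <- r | P k) F k y) x =
    \sum_(k <- r | P k) partial i (F k) x.
Proof.
move=> dF; elim: r => [|k r [IHd IH]].
  rewrite big_nil (_ : (fun _ => _) = fun=> 0) ?partial_cst//.
  by apply/funext => y; rewrite big_nil.
rewrite big_cons; case: (boolP (P k)) => Pk.
  rewrite (_ : (fun _ => _) = fun y => F k y + \sum_(k <- r | P k) F k y).
    split; first by apply: differentiableD => //; exact: dF.
    by rewrite partialD ?IH//; exact: dF.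
  by apply/funext => y; rewrite big_cons Pk.
rewrite (_ : (fun _ => _) = fun y => \sum_(k <- r | P k) F k y)//.
by apply/funext => y; rewrite big_cons (negPf Pk).
Qed.

Lemma derive_coord (v x : 'rV[R]_m) j : 'D_v (fun y : 'rV[R]_m => y 0 j) x = v 0 j.
Proof.
apply: cvg_lim => //; apply: cvg_near_cst.
near=> h.
have h0 : h != 0 by near: h; exact: nbhs_dnbhs_neq.
by rewrite /= !mxE addrK [_ *: _]mulrA mulVf ?mul1r.
Unshelve. all: by end_near. Qed.

Lemma partial_coord i j x : partial i (fun y => y 0 j) x = (i == j)%:R.
Proof. by rewrite /partial derive_coord mxE eqxx eq_sym. Qed.

Lemma smooth_coord j : smooth (fun x : 'rV[R]_m => x 0 j).
Proof.
apply: (smooth_coind [set f | f = (fun x => x 0 j) \/ smooth f]); last by left.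
move=> f [->|sf]; split=> [x|i].
- exact: differentiable_coord.
- right; rewrite (_ : partial _ _ = fun=> (i == j)%:R); first exact: smooth_cst.
  by apply/funext => x; exact: partial_coord.
- exact: smooth_differentiable.
- by right; exact: smooth_partial.
Qed.

End Smooth.

(** * Poisson bivectors *)

(* D l j k stands for the l-th partial derivative of B j k; f, g, h are the
   gradients and F, G, H the Hessians of three functions at a point. *)
Section BivectorAlgebra.
Context {R : comNzRingType} {I : finType}.
Implicit Types (f g h : I -> R) (F G H : I -> I -> R).
Variables (B : I -> I -> R) (D : I -> I -> I -> R).
Hypothesis BN : forall i j, B i j = - B j i.

(** In {f, {g, h}}, [U] collects the terms that differentiate the bivector, and [W] those that
    differentiate a gradient and so contain a Hessian. *)
Let U f g h : R := \sum_i \sum_j \sum_k f i * g j * h k * \sum_l B i l * D l j k.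

Let W f g G h : R :=
  \sum_i \sum_l \sum_j \sum_k B i l * f i * (B j k * G l j * h k).

Lemma nested_bracket f g G h H :
  \sum_i \sum_l B i l * f i * (\sum_j \sum_k
    (D l j k * g j * h k + B j k * G l j * h k + B j k * g j * H l k)) =
  U f g h + W f g G h - W f h H g.
Proof.
rewrite /U /W -sumrN -!big_split; apply: eq_bigr => i _ /=.
transitivity (\sum_l (\sum_j \sum_k B i l * f i * (D l j k * g j * h k)
   + \sum_j \sum_k B i l * f i * (B j k * G l j * h k)
   + \sum_j \sum_k B i l * f i * (B j k * g j * H l k))).
  apply: eq_bigr => l _; rewrite mulr_sumr -!big_split; apply: eq_bigr => j _ /=.
  rewrite mulr_sumr -!big_split; apply: eq_bigr => k _ /=; ring.
rewrite !big_split /=; congr (_ + _ + _).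
  rewrite exchange_big; apply: eq_bigr => j _ /=.
  rewrite exchange_big; apply: eq_bigr => k _ /=.
  rewrite mulr_sumr; apply: eq_bigr => l _; ring.
rewrite -sumrN; apply: eq_bigr => l _ /=.
rewrite exchange_big -sumrN; apply: eq_bigr => j _ /=.
rewrite -sumrN; apply: eq_bigr => k _; rewrite (BN k j); ring.
Qed.

(** Exchange i with k and l with j: the Hessian is symmetric and the two signs from [BN] cancel. *)
Let W_sym f g G h : (forall i j, G i j = G j i) -> W f g G h = W h g G f.
Proof.
move=> GC; rewrite /W.
under eq_bigr do under eq_bigr do rewrite exchange_big.
under eq_bigr do rewrite exchange_big.
rewrite exchange_big; apply: eq_bigr => i _ /=.
under eq_bigr do rewrite exchange_big.
rewrite exchange_big; apply: eq_bigr => l _ /=.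
rewrite exchange_big; apply: eq_bigr => j _ /=.
apply: eq_bigr => k _ ; rewrite GC (BN k j) (BN l i); ring.
Qed.

(** Renaming indices gives the rotated sums the common weight f_i g_j h_k, so that they can be added
    term by term. *)
Let U_rot f g h :
  U g h f = \sum_i \sum_j \sum_k f i * g j * h k * \sum_l B j l * D l k i.
Proof.
rewrite /U.
under eq_bigr do rewrite exchange_big.
rewrite exchange_big; apply: eq_bigr => i _ /=.
apply: eq_bigr => j _; apply: eq_bigr => k _; ring.
Qed.

Let U_rot2 f g h :
  U h f g = \sum_i \sum_j \sum_k f i * g j * h k * \sum_l B k l * D l i j.
Proof.
rewrite /U exchange_big; apply: eq_bigr => i _ /=.
rewrite exchange_big; apply: eq_bigr => j _ /=.
apply: eq_bigr => k _; ring.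
Qed.

Let nested f g G h H : R := \sum_i \sum_l B i l * f i * (\sum_j \sum_k
    (D l j k * g j * h k + B j k * G l j * h k + B j k * g j * H l k)).

(** By [W_sym] the six Hessian terms cancel in pairs; what remains is the Jacobi identity of the
    coordinates contracted with the three gradients. *)
Lemma bivector_jacobi f F g G h H :
  (forall i j, F i j = F j i) -> (forall i j, G i j = G j i) ->
  (forall i j, H i j = H j i) ->
  (forall i j k, \sum_l B i l * D l j k + \sum_l B j l * D l k i
     + \sum_l B k l * D l i j = 0) ->
  nested f g G h H + nested g h H f F + nested h f F g G = 0.
Proof.
move=> FC GC HC J; rewrite /nested !nested_bracket.
rewrite (W_sym h g) // (W_sym f h)// (W_sym g f)//.
transitivity (U f g h + U g h f + U h f g); first by ring.
rewrite U_rot U_rot2 -!big_split big1// => i _ /=.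
rewrite -!big_split big1// => j _ /=.
rewrite -!big_split big1// => k _ /=.
by rewrite -!mulrDr J mulr0.
Qed.

End BivectorAlgebra.

(** * From the Jacobi identity of coordinates to a Poisson bracket *)

Section BivectorPoisson.
Context {R : realType} {m : nat}.
Variable t : nat -> nat -> 'rV[R]_m -> R.
Let B (i j : 'I_m) : 'rV[R]_m -> R := skew_ext t i j.

Lemma skew_extC (i j : 'I_m) x : skew_ext t i j x = - skew_ext t j i x.
Proof. by rewrite /skew_ext; case: ltngtP; rewrite ?opprK ?oppr0. Qed.

Hypothesis sB : forall i j, smooth (B i j).
Hypothesis jacobiB : forall i j k x,
  \sum_l B i l x * partial l (B j k) x + \sum_l B j l x * partial l (B k i) x
     + \sum_l B k l x * partial l (B i j) x = 0.

Let smooth_bracket f g : smooth f -> smooth g -> smooth (bivector_bracket t f g).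
Proof.
move=> sf sg; apply: smooth_sum => i _; apply: smooth_sum => j _.
by apply: smoothM; [apply: smoothM|]; [exact: sB|exact: smooth_partial..].
Qed.

Let partial_bracket f g l x : smooth f -> smooth g ->
  partial l (bivector_bracket t f g) x = \sum_j \sum_k
   (partial l (B j k) x * partial j f x * partial k g x
   + B j k x * partial l (partial j f) x * partial k g x
   + B j k x * partial j f x * partial l (partial k g) x).
Proof.
move=> sf sg.
have sBf j k : smooth (fun y => B j k y * partial j f y).
  by apply: smoothM; [exact: sB|exact: smooth_partial].
have sBfg j k : smooth (fun y => B j k y * partial j f y * partial k g y).
  by apply: smoothM => //; exact: smooth_partial.
rewrite (partial_sum _ _ _ _ _ _ _).2; last first.
  by move=> j _; apply/smooth_differentiable/smooth_sum => k _; exact: sBfg.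
apply: eq_bigr => j _; rewrite (partial_sum _ _ _ _ _ _ _).2; last first.
  by move=> k _; apply/smooth_differentiable; exact: sBfg.
apply: eq_bigr => k _.
have dd f' : smooth f' -> differentiable f' x by exact: smooth_differentiable.
have sp i f' : smooth f' -> smooth (partial i f') by exact: smooth_partial.
rewrite (partialM _ (fun y => B j k y * partial j f y)); [|by auto..].
rewrite (partialM _ (B j k)); [|by auto..].
move: (B j k x) (partial j f x) (partial k g x) => b1 b2 b3.
move: (partial l _ x) (partial l _ x) (partial l _ x) => b4 b5 b6.
ring.
Qed.

Lemma poisson_bivector_bracket : poisson_bracket (bivector_bracket t).
Proof.
split=> //.
- move=> f g _ _ x; rewrite /bivector_bracket exchange_big -sumrN.
  apply: eq_bigr => i _; rewrite -sumrN; apply: eq_bigr => j _ /=.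
  by rewrite skew_extC mulrAC !mulNr.
- move=> c f g h sf sg sh x; rewrite /bivector_bracket mulr_sumr -big_split.
  apply: eq_bigr => i _; rewrite mulr_sumr -big_split; apply: eq_bigr => j _ /=.
  have scf := smoothM _ _ (smooth_cst c) sf.
  rewrite partialD ?partialM ?partial_cst; try exact: smooth_differentiable.
    by ring.
  exact/smooth_differentiable/smooth_cst.
- move=> f g h sf sg sh x; rewrite /bivector_bracket mulr_sumr mulr_suml -big_split.
  apply: eq_bigr => i _; rewrite mulr_sumr mulr_suml -big_split.
  apply: eq_bigr => j _ /=.
  rewrite partialM; try exact: smooth_differentiable.
  by ring.
- move=> f g h sf sg sh x.
  have E f' g' h' : smooth g' -> smooth h' ->
     bivector_bracket t f' (bivector_bracket t g' h') x =
     \sum_i \sum_l B i l x * partial i f' x * (\sum_j \sum_k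
       (partial l (B j k) x * partial j g' x * partial k h' x
       + B j k x * partial l (partial j g') x * partial k h' x
       + B j k x * partial j g' x * partial l (partial k h') x)).
    move=> sg' sh'; rewrite {1}/bivector_bracket.
    by apply: eq_bigr => i _; apply: eq_bigr => l _; rewrite partial_bracket.
  rewrite !E//.
  apply: (@bivector_jacobi _ _ (fun i j => B i j x)
    (fun l j k => partial l (B j k) x) _ (fun i => partial i f x)
    (fun l j => partial l (partial j f) x) (fun i => partial i g x)
    (fun l j => partial l (partial j g) x) (fun i => partial i h x)
    (fun l j => partial l (partial j h) x)).
  + by move=> i j; exact: skew_extC.
  + by move=> i j; exact: partialC.
  + by move=> i j; exact: partialC.
  + by move=> i j; exact: partialC.
  + by move=> i j k; exact: jacobiB.
Qed.

End BivectorPoisson.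

(** * Coordinates and exponentials *)

Section Coordinates.
Context {R : realType} {m : nat}.
Implicit Types (x v : 'rV[R]_m) (i j l : 'I_m) (k : nat).

Lemma co_ord x i : co x i.+1 = x 0 i.
Proof. by rewrite /co valK. Qed.

Lemma co_out x k : (0 < k <= m)%N = false -> co x k = 0.
Proof. by case: k => // k km; rewrite /co/= insubF. Qed.

Lemma co_ord_fun i : (fun x => co x i.+1) = fun x => x 0 i.
Proof. by apply/funext => x; exact: co_ord. Qed.

Lemma co_out_fun k : (0 < k <= m)%N = false -> (fun x => co x k) = fun=> 0.
Proof. by move=> km; apply/funext => x; exact: co_out. Qed.

Lemma co_ord_or_out k : (exists i : 'I_m, k = i.+1) \/ (0 < k <= m)%N = false.
Proof.
case: k => [|k]; first by right.
by case: (ltnP k m) => [km|km]; [left; exists (Ordinal km)|right].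
Qed.

Lemma smooth_co k : smooth (fun x : 'rV[R]_m => co x k).
Proof.
have [[i ->]|km] := co_ord_or_out k.
  by rewrite co_ord_fun; exact: smooth_coord.
by rewrite co_out_fun//; exact: smooth_cst.
Qed.

Lemma derive_co v x k : 'D_v (fun y => co y k) x = co v k.
Proof.
have [[i ->]|km] := co_ord_or_out k.
  by rewrite co_ord_fun; rewrite derive_coord co_ord.
by rewrite co_out_fun// derive_cst co_out.
Qed.

Lemma co_delta l k : co (delta_mx 0 l : 'rV[R]_m) k = (l.+1 == k)%:R.
Proof.
have [[i ->]|km] := co_ord_or_out k.
  by rewrite co_ord mxE eqxx eq_sym.
rewrite co_out//; case: eqP => // lk; move: km.
by rewrite -lk ltnS leq0n ltn_ord.
Qed.

Lemma expq_expR x k : (0 < k < m)%N -> expq x k = expR (co x k - co x k.+1).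
Proof. by rewrite /expq => ->. Qed.

Lemma expq_out x k : (0 < k < m)%N = false -> expq x k = 0.
Proof. by rewrite /expq => ->. Qed.

Lemma smooth_expq k : smooth (fun x : 'rV[R]_m => expq x k).
Proof.
rewrite /expq; case: (0 < k < m)%N; last exact: smooth_cst.
by apply/smooth_expR/smoothB; exact: smooth_co.
Qed.

Lemma derive_expq v x k :
  'D_v (fun y => expq y k) x = expq x k * (co v k - co v k.+1).
Proof.
have dco k' : differentiable (fun y : 'rV[R]_m => co y k') x.
  exact/smooth_differentiable/smooth_co.
rewrite /expq; case: (0 < k < m)%N; last by rewrite mul0r derive_cst.
have dB := differentiableB (dco k) (dco k.+1).
have [de E] := is_diff_expR_comp _ _ dB.
rewrite deriveE//= E -deriveE// deriveB ?derive_co 1?mulrC//.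
all: exact: diff_derivable.
Qed.

Lemma partial_expq l x k : partial l (fun y => expq y k) x =
  expq x k * ((l.+1 == k)%:R - (l.+1 == k.+1)%:R).
Proof. by rewrite /partial derive_expq !co_delta. Qed.

End Coordinates.

Section Bivector.
Context {R : realType} {m : nat}.
Implicit Types (x : 'rV[R]_m) (t : nat -> nat -> 'rV[R]_m -> R).

Lemma skew_extE t (i j : 'I_m) x :
  skew_ext t i j x = skewn (fun i j => t i j x) i.+1 j.+1.
Proof. by []. Qed.

Lemma bracket_mx_bivector t x :
  bracket_mx (bivector_bracket t) x = \matrix_(i, j) skew_ext t i j x.
Proof.
apply/matrixP => i j; rewrite !mxE /bivector_bracket.
under eq_bigr do under eq_bigr do rewrite !partial_coord.
rewrite (bigD1 i)//= [X in _ + X]big1 ?addr0 => [|k /negbTE ki]; last first.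
  by apply: big1 => l _; rewrite ki mulr0 mul0r.
rewrite (bigD1 j)//= [X in _ + X]big1 ?addr0 => [|k /negbTE kj]; last by rewrite kj mulr0.
by rewrite !eqxx !mulr1.
Qed.

Lemma smooth_skew_ext t (i j : 'I_m) :
  (forall i j, smooth (t i j)) -> smooth (skew_ext t i j).
Proof.
move=> st; rewrite /skew_ext; case: ltngtP => _ //.
  by apply: smoothN; exact: st.
exact: smooth_cst.
Qed.

(** The derivation rule for a_k along a vector field with components b. Outside 0 < k < m both sides
    vanish with [expq]. *)
Lemma sum_skewn_partial_expq (b : nat -> R) k x :
  \sum_(l < m) b l.+1 * partial l (fun y => expq y k) x =
  expq x k * (b k - b k.+1).
Proof.
have [/andP[k0 km]|/negbTE km] := boolP (0 < k < m)%N; last first.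
  rewrite expq_out// mul0r big1// => l _.
  by rewrite partial_expq expq_out// mul0r mulr0.
transitivity (\sum_(l < m) ((l == k.-1 :> nat)%:R * (expq x k * b l.+1)
   - (l == k :> nat)%:R * (expq x k * b l.+1))).
  apply: eq_bigr => l _; rewrite partial_expq eqSS -[in l.+1 == k](prednK k0) eqSS.
  by rewrite -mulrBl mulrA [RHS]mulrC (mulrC (b _)).
rewrite big_split sumrN/= !(sum_ord_eq _ _ (fun l => expq x k * b l.+1)) km.
by rewrite (leq_ltn_trans (leq_pred k) km) (prednK k0) !mul1r mulrBr.
Qed.

End Bivector.

(** * Chain rule and Poisson maps *)

Section ChainRule.
Context {R : realType} {m p : nat}.
Implicit Types (F : 'rV[R]_m -> 'rV[R]_p) (x v : 'rV[R]_m).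

Lemma differentiable_rV F x :
  (forall j, differentiable (fun y => F y 0 j) x) -> differentiable F x.
Proof.
move=> dF; rewrite (_ : F = \sum_j (fun y => F y 0 j *: delta_mx 0 j)).
  by apply: differentiable_sum => j; exact: differentiableZl.
apply/funext => y; rewrite fct_sumE [LHS]row_sum_delta.
by apply: eq_bigr.
Qed.

Lemma diff_rV F x v j : differentiable F x ->
  ('d F x v : 'rV_p) 0 j = 'D_v (fun y => F y 0 j) x.
Proof.
by move=> dF; rewrite -deriveE// derive_mx ?mxE//; exact: diff_derivable.
Qed.

Lemma partial_comp (f : 'rV[R]_p -> R) F x i :
  differentiable F x -> differentiable f (F x) ->
  partial i (f \o F) x =
  \sum_k partial i (fun y => F y 0 k) x * partial k f (F x).
Proof.
move=> dF df; rewrite /partial deriveE; last exact: differentiable_comp.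
rewrite diff_comp//= [X in 'd f _ X]row_sum_delta linear_sum.
apply: eq_bigr => k _.
by rewrite linearZ/= diff_rV// -deriveE.
Qed.

(** By the chain rule both brackets are contractions with the gradients of f and g at F x, so the
    coordinate functions suffice. *)
Lemma poisson_map_bivector t t' F (V : set 'rV[R]_p) :
  (forall x, differentiable F x) -> (forall x, V (F x)) ->
  (forall x k l, bivector_bracket t (fun y => F y 0 k) (fun y => F y 0 l) x =
                 skew_ext t' k l (F x)) ->
  poisson_map (bivector_bracket t) V (bivector_bracket t') F.
Proof.
move=> dF VF tt' f g sf sg x.
rewrite /bivector_bracket.
have pc h i : smooth_on V h ->
    partial i (h \o F) x = \sum_k partial i (fun y => F y 0 k) x * partial k h (F x).
  by move=> sh; apply: partial_comp => //; exact: (sh [::] _ (VF x)).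
under eq_bigr do under eq_bigr do rewrite (pc _ _ sf) (pc _ _ sg).
transitivity (\sum_i \sum_j \sum_k \sum_l (skew_ext t i j x *
    partial i (fun y => F y 0 k) x * partial j (fun y => F y 0 l) x *
    (partial k f (F x) * partial l g (F x)))).
  apply: eq_bigr => i _; apply: eq_bigr => j _.
  rewrite -mulrA mulr_suml mulr_sumr; apply: eq_bigr => k _.
  by rewrite !mulr_sumr; apply: eq_bigr => l _; ring.
under eq_bigr do rewrite exchange_big.
rewrite exchange_big; apply: eq_bigr => k _ /=.
under eq_bigr do rewrite exchange_big.
rewrite exchange_big; apply: eq_bigr => l _ /=.
rewrite -tt' /bivector_bracket !mulr_suml; apply: eq_bigr => i _ /=.
by rewrite !mulr_suml; apply: eq_bigr => j _; ring.
Qed.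

End ChainRule.

(** * The realization *)

Section Realization.
Context {R : realType} {N : nat}.
Implicit Types (q v : 'rV[R]_N) (t : nat -> nat -> 'rV[R]_N -> R) (d : nat -> R).

(** The derivation rule is applied in the second argument, then in the first. *)
Lemma bracket_expq t k l q :
  bivector_bracket t (fun y => expq y k) (fun y => expq y l) q =
  exp_bracket (expq q) (skewn (fun i j => t i j q)) k l.
Proof.
pose s := skewn (fun i j => t i j q).
pose b i := expq q l * (s i l - s i l.+1).
transitivity (\sum_(i < N) b i.+1 * partial i (fun y => expq y k) q).
  apply: eq_bigr => i _; rewrite /b -(sum_skewn_partial_expq (s i.+1)) mulr_suml.
  by apply: eq_bigr => j _; rewrite skew_extE mulrAC.
rewrite sum_skewn_partial_expq /b /exp_bracket -/s; ring.
Qed.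

Lemma poisson_w2 : poisson_bracket (@w2 R N).
Proof.
apply: poisson_bivector_bracket => [i j|i j k x].
  by apply: smooth_skew_ext => *; exact: smooth_cst.
have cst i' j' l : partial l (skew_ext (fun _ _ _ => 1) i' j' : 'rV[R]_N -> R) x = 0.
  by rewrite /skew_ext; case: ltngtP => _; rewrite partial_cst.
by rewrite !big1 ?addr0// => l _; rewrite cst mulr0.
Qed.

Let B3 : nat -> nat -> 'rV[R]_N -> R := fun i j q => w3_coef (expq q) i j.

Lemma w3E : @w3 R N = bivector_bracket B3.
Proof. by []. Qed.

Let smooth_B3 i j : smooth (B3 i j).
Proof.
have se k := @smooth_expq R N k.
by do 3?apply: smoothD => //; apply: smoothM => //; exact: smooth_cst.
Qed.

(** By linearity of [w3_coef], differentiating along b replaces each a_k by its derivative. With b_l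
    = {q_i, q_l} this computes {q_i, {q_j, q_k}}. *)
Let sum_partial_B3 (b : nat -> R) (a := fun q k => expq q k * (b k - b k.+1)) (j k : 'I_N) q :
  \sum_(l < N) b l.+1 * partial l (skew_ext B3 j k) q = skewn (w3_coef (a q)) j.+1 k.+1.
Proof.
have de i y : differentiable (fun z : 'rV[R]_N => expq z i) y.
  exact/smooth_differentiable/smooth_expq.
have ham i j' : \sum_(l < N) b l.+1 * partial l (B3 i j') q = w3_coef (a q) i j'.
  rewrite /w3_coef /a -!sum_skewn_partial_expq mulr_sumr -!big_split.
  apply: eq_bigr => l _ /=; rewrite /B3 /w3_coef.
  rewrite !partialD ?partialM ?partial_cst//.
    by ring.
  all: try by repeat first [apply: differentiableD|apply: differentiableM|exact: differentiable_cst|exact: de].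
rewrite /skewn /skew_ext !ltnS; case: ltngtP => _.
- exact: ham.
- rewrite -ham -sumrN; apply: eq_bigr => l _.
  rewrite /partial deriveN ?mulrN//; exact/smooth_derivable/smooth_B3.
- by rewrite big1// => l _; rewrite partial_cst mulr0.
Qed.

Lemma poisson_w3 : poisson_bracket (@w3 R N).
Proof.
rewrite w3E; apply: poisson_bivector_bracket => [i j|i j k x].
  exact: smooth_skew_ext.
have H (i' j' k' : 'I_N) :
  \sum_l skew_ext B3 i' l x * partial l (skew_ext B3 j' k') x =
  skewn (w3_coef (coord_exp_bracket (expq x) i'.+1)) j'.+1 k'.+1.
  exact: (sum_partial_B3 (skewn (w3_coef (expq x)) i'.+1)).
rewrite -[RHS](@skewn_w3_coef_jacobi _ (expq x) i.+1 j.+1 k.+1)//.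
by congr (_ + _ + _); exact: H.
Qed.

Lemma G_ord q (k : 'I_N.-1) : G q 0 k = expq q k.+1.
Proof. by rewrite mxE expq_expR//=; have := ltn_ord k; lia. Qed.

Lemma G_fun (k : 'I_N.-1) : (fun q => G q 0 k) = fun q => expq q k.+1.
Proof. by apply/funext => q; exact: G_ord. Qed.

(** An equality of whole sequences: both vanish outside 1, ..., N-1, so the boundary conventions of
    [v2], [v3] and [w3] agree. *)
Lemma co_G q : co (G q) = expq q.
Proof.
apply/funext => k; have [[i ->]|km] := @co_ord_or_out N.-1 k.
  by rewrite co_ord G_ord.
by rewrite co_out// expq_out//; lia.
Qed.

Lemma Va_G q : @Va R N (G q).
Proof. by move=> k; rewrite mxE expR_gt0. Qed.

Lemma smooth_G : smooth_map (@G R N).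
Proof. by move=> k; rewrite G_fun; exact: smooth_expq. Qed.

Lemma differentiable_G q : differentiable (@G R N) q.
Proof.
by apply: differentiable_rV => k; exact/smooth_differentiable/smooth_G.
Qed.

(** The solution of q_k - q_(k+1) = d_k with q_N = 0. It inverts G after taking logarithms, and also
    its differential. *)
Definition tail_sums d : 'rV[R]_N := \row_k \sum_(k.+1 <= m < N) d m.

Lemma co_tail_sums d k : (0 < k < N)%N ->
  co (tail_sums d) k - co (tail_sums d) k.+1 = d k.
Proof.
have E i : (i < N)%N -> co (tail_sums d) i.+1 = \sum_(i.+1 <= m < N) d m.
  by move=> iN; rewrite -[i]/(nat_of_ord (Ordinal iN)) co_ord mxE.
case: k => // k /andP[_ kN]; rewrite !E ?(ltnW kN)//.
by rewrite big_ltn// addrK.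
Qed.

Lemma range_G : range (@G R N) = @Va R N.
Proof.
apply/seteqP; split=> [_ [q _ <-]|a a0]; first exact: Va_G.
exists (tail_sums (fun m => ln (co a m))) => //.
apply/rowP => k; rewrite G_ord expq_expR; last by have := ltn_ord k; lia.
rewrite co_tail_sums; last by have := ltn_ord k; lia.
by rewrite co_ord lnK// posrE.
Qed.

Lemma submersion_G : submersion (@G R N).
Proof.
split=> [|q]; first exact: smooth_G.
apply/seteqP; split=> // w _.
(* Component m of the differential of G at q sends v to a_m (v_m - v_(m+1)), hence the division by
   a_m. *)
exists (tail_sums (fun m => co w m / expq q m)) => //.
apply/rowP => k; have kN : (0 < k.+1 < N)%N by have := ltn_ord k; lia.
rewrite diff_rV; last exact: differentiable_G.
rewrite G_fun derive_expq co_tail_sums// co_ord mulrC divfK//.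
by rewrite expq_expR// expR_eq0.
Qed.

Lemma poisson_map_G t (t' : nat -> nat -> 'rV[R]_N.-1 -> R) :
  (forall q i j, (0 < i)%N -> (0 < j)%N ->
    exp_bracket (expq q) (skewn (fun i j => t i j q)) i j =
    skewn (fun i j => t' i j (G q)) i j) ->
  poisson_map (bivector_bracket t) (@Va R N) (bivector_bracket t') (@G R N).
Proof.
move=> tt'; apply: poisson_map_bivector => [q|q|q k l].
- exact: differentiable_G.
- exact: Va_G.
- by rewrite !G_fun bracket_expq tt'.
Qed.

Lemma poisson_map_G_w2 : poisson_map (@w2 R N) (@Va R N) (@v2 R N) (@G R N).
Proof.
by apply: poisson_map_G => q i j i0 j0; rewrite exp_bracket_quadratic// co_G.
Qed.

Lemma poisson_map_G_w3 : poisson_map (@w3 R N) (@Va R N) (@v3 R N) (@G R N).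
Proof.
by apply: poisson_map_G => q i j i0 j0; rewrite exp_bracket_cubic// co_G.
Qed.

Lemma i1_expq : @i1 R N = fun q => \sum_(1 <= k < N) expq q k.
Proof.
apply/funext => q; rewrite /i1 !big_nat; apply: eq_bigr => k kN.
by rewrite expq_expR.
Qed.

Lemma laxE (a : 'rV[R]_N.-1) : lax a = tridiag (fun=> 1) (fun k => co a k.+1) N.
Proof. by []. Qed.

Lemma i1_G q : i1 q = I1 (G q).
Proof.
rewrite i1_expq /I1 laxE mxtrace_sqr_tridiag mulKf ?pnatr_eq0//.
rewrite co_G; case: N q => [|M] q; first by rewrite big_ord0 big_geq.
rewrite big_add1 big_mkord; apply: eq_bigr => k _; by rewrite mul1r.
Qed.

Lemma i0_alternating M q : N = (2 * M)%N ->
  i0 q = \sum_(k < M) (co q (2 * k).+1 - co q (2 * k).+2).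
Proof. by move=> NM; rewrite /i0 (congr1 S NM) sum_alternating. Qed.

(** Only a_1, a_3, ..., a_(N-1) survive in the determinant of the Lax matrix, and the logarithm of
    their product is the alternating sum. *)
Lemma i0_G M q : N = (2 * M)%N -> i0 q = I0 (G q).
Proof.
move=> NM; rewrite (i0_alternating M)// /I0 laxE co_G.
have -> : \det (tridiag (fun=> 1) (fun k => expq q k.+1) N) =
    \det (tridiag (fun=> 1) (fun k => expq q k.+1) (2 * M)).
  by move: (fun k => expq q k.+1) => l; rewrite NM.
rewrite det_tridiag normr_prod -[LHS]expRK expR_sum; congr ln.
apply: eq_bigr => k _.
rewrite mul1r normrN expq_expR ?gtr0_norm ?expR_gt0//.
by have := ltn_ord k; lia.
Qed.

(** The two Hamiltonian vector fields are compared componentwise: along q_i both equal -(a_(i-1) +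
    a_i). *)
Lemma bi_hamiltonian M (f : 'rV[R]_N -> R) q : N = (2 * M)%N ->
  w2 f (@i1 R N) q = w3 f (@i0 R N) q.
Proof.
move=> NM; have [M0|M0] := posnP M.
  by rewrite /w2 /w3 /bivector_bracket !big1// => i; have := ltn_ord i; lia.
apply: eq_bigr => i _.
have a0 : expq q 0 = 0 by rewrite expq_out.
have aN : expq q N = 0 by rewrite expq_out// ltnn andbF.
have dif k : differentiable (fun y : 'rV[R]_N => expq y k) q.
  exact/smooth_differentiable/smooth_expq.
under eq_bigr do rewrite mulrAC; rewrite -mulr_suml.
under [RHS]eq_bigr do rewrite mulrAC; rewrite -[RHS]mulr_suml; congr (_ * _).
(* The ordinal [i] stands for the coordinate numbered i + 1, so its neighbouring exponentials are
   a_i and a_(i+1). *)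
transitivity (- (expq q i + expq q i.+1)).
  under eq_bigr do rewrite i1_expq (partial_sum _ _ _ _ _ _ (fun k _ => dif k)).2 mulr_sumr.
  rewrite exchange_big/=.
  under eq_bigr do rewrite (sum_skewn_partial_expq (skewn (fun _ _ => 1) i.+1)).
  by rewrite sum_exp_bracket_ones//= ltn_ord.
have pi0 (j : 'I_N) : partial j (@i0 R N) q = (-1) ^+ j.+2.
  have dco k : differentiable (fun y : 'rV[R]_N => (-1) ^+ k.+1 * co y k) q.
    by apply/smooth_differentiable/smoothM; [exact: smooth_cst|exact: smooth_co].
  rewrite (partial_sum _ _ _ _ _ _ (fun k _ => dco k)).2 big_add1 big_mkord.
  transitivity (\sum_(k < N) (k == j :> nat)%:R * (-1) ^+ k.+2 : R).
    apply: eq_bigr => k _; rewrite partialM ?partial_cst.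
    + by rewrite mulr0 addr0 /partial derive_co co_delta mulrC eqSS eq_sym.
    + exact: differentiable_cst.
    + exact/smooth_differentiable/smooth_co.
  by rewrite (sum_ord_eq _ _ (fun k => (-1) ^+ k.+2)) ltn_ord mul1r.
under eq_bigr do rewrite pi0.
rewrite -(big_mkord xpredT (fun j => skewn (w3_coef (expq q)) i.+1 j.+1 * (-1) ^+ j.+2)).
rewrite -(big_add1 _ _ 0 N.+1 xpredT (fun j => skewn (w3_coef (expq q)) i.+1 j * (-1) ^+ j.+1)).
under eq_bigr do rewrite mulrC.
(* Since 2M = N, the boundary term left by the alternating sum is a multiple of a_N = 0. *)
rewrite (congr1 S NM) sum_alternating alternating_sum_w3_coef// -NM ltn_ord aN.
by rewrite mulr0 subr0.
Qed.

Lemma det_w2 M q : N = (2 * M)%N -> \det (bracket_mx (@w2 R N) q) = 1.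
Proof.
move=> NM; rewrite bracket_mx_bivector -[RHS](det_skew_ones M).
have -> : \matrix_(i, j) skew_ext (fun _ _ _ => 1) i j q =
  \matrix_(i < N, j < N) ((i < j)%N%:R - (j < i)%N%:R : R).
  apply/matrixP => i j; rewrite !mxE /skew_ext.
  by case: ltngtP => _; rewrite ?subr0 ?sub0r.
by rewrite NM.
Qed.

End Realization.

Theorem mainTheorem1 (R : realType) (n N : nat) (hN : N = (2 * n.+1)%N) :
  (* (1) *)
  [/\ symplectic_bracket (@w2 R N),
      forall q : 'rV[R]_N, \det (bracket_mx (@w2 R N) q) = 1
    & poisson_bracket (@w3 R N)] /\
  (* (2) *)
  [/\ range (@G R N) = @Va R N,
      submersion (@G R N),
      poisson_map (@w2 R N) (@Va R N) (@v2 R N) (@G R N)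
    & poisson_map (@w3 R N) (@Va R N) (@v3 R N) (@G R N)] /\
  (* (3) *)
  (forall q : 'rV[R]_N, i1 q = I1 (G q) /\ i0 q = I0 (G q)) /\
  (* (4) *)
  (forall f : 'rV[R]_N -> R, smooth f ->
     forall q : 'rV[R]_N, w2 f (@i1 R N) q = w3 f (@i0 R N) q).
Proof.
have det1 q := @det_w2 R N n.+1 q hN.
split; last split; last split.
- split=> //; last exact: poisson_w3.
  split=> [|q]; first exact: poisson_w2.
  by rewrite unitmxE det1 unitr1.
- by split; [exact: range_G|exact: submersion_G|exact: poisson_map_G_w2|
             exact: poisson_map_G_w3].
- by move=> q; split; [exact: i1_G|exact: (i0_G n.+1)].
- by move=> f _ q; exact: (bi_hamiltonian n.+1).
Qed.
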